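(* Let $u^i_t=f^i(u)_x$, $i=1,\dots,n$, be a strictly hyperbolic system of conservation laws with characteristic velocities $\lambda^1,\dots,\lambda^n$, and let its associated congruence be the $n$-parameter family of lines $y^i=u^i y^0-f^i(u)$, $i=1,\dots,n$, in the affine space $A^{n+1}$ with coordinates $y^0,\dots,y^n$. Let $\varphi(u)$ be a function with $\varphi\neq\lambda^i$ for all $i$, and let $M^n\subset A^{n+1}$ be the hypersurface parametrized by $u$ with radius-vector $$\mathbf r(u)=\left(\varphi,\ u^1\varphi-f^1,\ \dots,\ u^n\varphi-f^n\right).$$ Then (locally) $M^n$ is conjugate to the congruence if and only if $\varphi$ is representable in the form $\varphi=g/h$, where $h(u)_t=g(u)_x$ is a conservation law of the system $u^i_t=f^i(u)_x$.
   Context: All functions are smooth and all considerations are local (on a small simply connected domain in the space of $u=(u^1,\dots,u^n)$). Summation over repeated indices is understood. For a system $u^i_t=f^i(u)_x=v^i_j(u)u^j_x$, $v^i_j=\partial f^i/\partial u^j$, the characteristic velocities $\lambda^i(u)$ are the eigenvalues of the matrix $v=(v^i_j)$. Strict hyperbolicity means that they are real and pairwise distinct. Let $\xi_i=(\xi_i^1,\dots,\xi_i^n)^t$ be right eigenvectors, $v\,\xi_i=\lambda^i\xi_i$, and let $L_i=\xi_i^k\,\partial/\partial u^k$ be the derivative along the vector field $\xi_i$. A conservation law $h(u)_t=g(u)_x$ of the system is a pair of functions $h,g$ of $u$ such that $\frac{\partial g}{\partial u^k}=\frac{\partial h}{\partial u^s}v^s_k$ for all $k$, equivalently $L_ig=\lambda^iL_ih$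 for $i=1,\dots,n$. In the representation $\varphi=g/h$, the density $h$ is nowhere zero on the domain considered. The hypersurface $M^n$ with radius-vector $\mathbf r(u)$ is called conjugate to the congruence if $L_iL_j\mathbf r\in TM^n$ (the tangent space of $M^n$ at the corresponding point, spanned by $L_1\mathbf r,\dots,L_n\mathbf r$) for all $i\neq j$. This condition does not depend on the normalization of the eigenvectors. *)

(* Defs.v *)
From HB Require Import structures.
From mathcomp Require Import all_boot all_order all_algebra.
From mathcomp Require Import all_classical all_reals all_analysis.
Import Order.TTheory GRing.Theory Num.Theory.
Import numFieldNormedType.Exports.

Set Implicit Arguments.
Unset Strict Implicit.
Unset Printing Implicit Defensive.

Local Open Scope classical_set_scope.
Local Open Scope ring_scope.

(* Points u = (u^1, ..., u^n) are row vectors.  All maps are total functions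
   on R^n of which only the values on an open set U are used; since U is open,
   derivatives at points of U depend on these values only. *)

Section Calculus.
Variables (R : realType) (n : nat) (V : normedModType R).
Implicit Types (U : set 'rV[R]_n) (F : 'rV[R]_n -> V).

Definition partial (k : 'I_n) F : 'rV[R]_n -> V := 'D_(delta_mx 0 k) F.

Fixpoint class_C (m : nat) U F : Prop :=
  if m is m'.+1 then
    (forall u, U u -> differentiable F u) /\
    (forall k : 'I_n, class_C m' U (partial k F))
  else forall u, U u -> {for u, continuous F}.

Definition smooth_on U F : Prop := forall m, class_C m U F.

Definition lie (xi : 'rV[R]_n -> 'cV[R]_n) F : 'rV[R]_n -> V :=
  fun u => \sum_(k < n) xi u k 0 *: partial k F u.

End Calculus.

Section System.
Variables (R : realType) (n : nat).
Implicit Types (U : set 'rV[R]_n) (f : 'rV[R]_n -> 'rV[R]_n).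
Implicit Types (lambda : 'I_n -> 'rV[R]_n -> R).
Implicit Types (xi : 'I_n -> 'rV[R]_n -> 'cV[R]_n).
Implicit Types (phi h g : 'rV[R]_n -> R).

Definition velocity_mx f (u : 'rV[R]_n) : 'M[R]_n :=
  \matrix_(i, j) partial j (fun w => f w 0 i : R^o) u.

Definition strictly_hyperbolic U f lambda : Prop :=
  forall u, U u ->
    (forall i, eigenvalue (velocity_mx f u) (lambda i u)) /\
    injective (fun i => lambda i u).

Definition right_eigenvectors U f lambda xi : Prop :=
  forall u, U u -> forall i,
    xi i u != 0 /\ velocity_mx f u *m xi i u = lambda i u *: xi i u.

Definition conservation_law U f h g : Prop :=
  [/\ smooth_on U (h : _ -> R^o), smooth_on U (g : _ -> R^o) &
      forall u, U u -> forall k : 'I_n,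
        partial k (g : _ -> R^o) u =
        \sum_(s < n) partial s (h : _ -> R^o) u * velocity_mx f u s k].

Definition representable U f phi : Prop :=
  exists h g, [/\ conservation_law U f h g,
                  forall u, U u -> h u != 0 &
                  forall u, U u -> phi u = g u / h u].

(* Balls for the sup norm are cubes, hence simply connected domains. *)
Definition locally_representable U f phi : Prop :=
  forall u0, U u0 -> exists e : R,
    [/\ 0 < e, ball u0 e `<=` U & representable (ball u0 e) f phi].

(* Points of A^{n+1} are row vectors of length 1 + n: y^0 is the entry of
   index lshift n 0, and y^i the entry of index rshift 1 i. *)
Definition congruence_line f (u : 'rV[R]_n) : set 'rV[R]_(1 + n) :=
  [set y | forall i : 'I_n,
    y 0 (rshift 1 i) = u 0 i * y 0 (lshift n 0) - f u 0 i].

Definition radius_vector f phi (u : 'rV[R]_n) : 'rV[R]_(1 + n) :=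
  row_mx (phi u)%:M (phi u *: u - f u).

Lemma radius_vector_on_line f phi u :
  congruence_line f u (radius_vector f phi u).
Proof.
by move=> i; rewrite /radius_vector row_mxEr row_mxEl !mxE eqxx mulr1n mulrC.
Qed.

(* The row space of this matrix is the tangent space of the hypersurface with
   radius-vector r, spanned by L_1 r, ..., L_n r. *)
Definition tangent_space xi (r : 'rV[R]_n -> 'rV[R]_(1 + n)) (u : 'rV[R]_n)
    : 'M[R]_(n, 1 + n) :=
  \matrix_(k < n) lie (xi k) r u.

(* The congruence enters through the right eigenvectors xi of its system. *)
Definition conjugate_to_congruence U xi (r : 'rV[R]_n -> 'rV[R]_(1 + n)) :
    Prop :=
  forall u, U u -> forall i j : 'I_n, i != j ->
    (lie (xi i) (lie (xi j) r) u <= tangent_space xi r u)%MS.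

End System.

(* Main.v *)
Require Import Defs.
From HB Require Import structures.
From mathcomp Require Import all_boot all_order all_algebra.
From mathcomp Require Import all_classical all_reals all_analysis.
From mathcomp Require Import ring lra.
Import Order.TTheory GRing.Theory Num.Theory.
Import numFieldNormedType.Exports.

(** Write v for the velocity matrix, N = phi - v, and let alpha be the 1-form
    alpha = - dphi N^-1, which exists because phi avoids the eigenvalues of v.
    The conormal A = (1 - alpha(u), alpha) annihilates every L_j r, and spans
    the annihilator of the tangent space, which has rank n.  Hence L_i L_j r is
    tangent if and only if A (L_i L_j r) = 0, and by differentiating the
    identity A (L_j r) = 0 this amounts to (L_i A)(L_j r) = 0.  A computation
    with the jacobians of r and A gives

      (L_i A)(L_j r) = (phi - lambda^j) Q(xi_j, xi_i),
      Q_sl = d_l alpha_s + alpha_s alpha_l,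

    so that the hypersurface is conjugate to the congruence if and only if
    Q(xi_j, xi_i) = 0 for all i <> j ([conjugate_at]).

    If this holds, Q is diagonal in the basis of eigenvectors, hence symmetric,
    so alpha is closed.  By the Poincare lemma ([poincare]) alpha = dpsi on
    each ball contained in the domain; h = exp psi and g = phi h then satisfy
    dg = h (dphi + phi alpha) = h alpha v = dh v.

    Conversely, if phi = g / h with dg = dh v, then alpha = dh / h solves
    alpha N = - dphi, and h Q is the Hessian H of h.  Differentiating
    dg = dh v and using the symmetry of the second derivatives of g and of f
    ([young]), one finds that H v is symmetric, so eigenvectors of v for
    distinct eigenvalues are H-orthogonal ([orth_eigen]) and Q(xi_j, xi_i) = 0.

    The Poincare lemma is proved with the ray primitive
    psi(u) = int_0^1 alpha(u0 + t (u - u0)) (u - u0) dt, by differentiation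
    under the integral sign: since alpha is closed, the derivative of the
    integrand in a direction w is d/dt (t alpha(u0 + t (u - u0)) w). *)

Set Implicit Arguments.
Unset Strict Implicit.
Unset Printing Implicit Defensive.

Local Open Scope classical_set_scope.
Local Open Scope ring_scope.

(** * Directional derivatives and the classes C^m *)

Section Frechet.
Variables (R : realType) (W V : normedModType R).
Implicit Types (U : set W) (F G : W -> V).

(** Differentiability from an explicit first-order estimate. *)
Lemma differentiable_eps F (u : W) (L : {linear W -> V}) : continuous L ->
  (forall e, 0 < e -> \forall h \near (0 : W),
     `|F (h + u) - F u - L h| <= e * `|h|) ->
  differentiable F u.
Proof.
move=> cL oF; have FL : F \o shift u = cst (F u) + L +o_ 0 id.
  apply/eqaddoP => e e0; near=> h.
  rewrite !fctE/= opprD addrA; near: h; exact: oF.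
by apply/diff_locallyP; rewrite (diff_unique cL FL).
Unshelve. all: by end_near. Qed.

Lemma near_open U F G u : open U -> U u -> {in U, F =1 G} ->
  {near u, F =1 G}.
Proof.
move=> oU Uu FG; have := open_nbhs_nbhs (conj oU Uu).
by apply: filterS => w Uw; apply: FG; rewrite inE.
Qed.

Lemma eq_differentiable U F G u : open U -> U u -> {in U, F =1 G} ->
  differentiable F u -> differentiable G u.
Proof.
move=> oU Uu FG dF; have nFG := near_open oU Uu FG.
have Guu : F u = G u by apply: FG; rewrite inE.
have [cd /eqaddoP oF] := (diff_locallyP u F).1 dF.
apply: (differentiable_eps (L := 'd F u)) => // e e0.
have nG : \forall h \near (0 : W), F (h + u) = G (h + u).
  have := nFG; rewrite (near_shift 0) subr0; apply: filterS => h /=.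
  by rewrite /= => ->.
near=> h; rewrite -Guu -(near nG h)//.
have -> : F (h + u) - F u - 'd F u h = (F \o shift u - (cst (F u) + 'd F u)) h.
  by rewrite !fctE/= opprD addrA.
by near: h; apply: oF.
Unshelve. all: by end_near. Qed.

End Frechet.

Section Directional.
Variables (R : realType) (n : nat) (V : normedModType R).
Implicit Types (U : set 'rV[R]_n) (F G : 'rV[R]_n -> V).

Lemma derive_sum_partial F (u v : 'rV[R]_n) : differentiable F u ->
  'D_v F u = \sum_(k < n) v 0 k *: partial k F u.
Proof.
move=> dF; rewrite deriveE// {1}(row_sum_delta v) linear_sum.
by apply: eq_bigr => k _; rewrite linearZ /partial deriveE.
Qed.

Lemma eq_partial U F G u k : open U -> U u -> {in U, F =1 G} ->
  partial k F u = partial k G u.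
Proof. by move=> oU Uu FG; apply: near_eq_derive; exact: near_open FG. Qed.

Lemma eq_class_C m U F G : open U -> {in U, F =1 G} ->
  class_C m U F -> class_C m U G.
Proof.
move=> oU; elim: m F G => [|m IH] F G FG /=.
  move=> cF u Uu; have nFG := near_open oU Uu FG.
  have cFu : F w @[w --> u] --> G u by rewrite -(FG u) ?inE//; exact: cF.
  rewrite /continuous_at.
  by apply: cvg_trans cFu; exact: near_eq_cvg nFG.
move=> [dF cF]; split=> [u Uu|k].
  exact: (eq_differentiable oU Uu FG (dF u Uu)).
apply: IH (cF k) => u; rewrite inE => Uu; exact: eq_partial FG.
Qed.

Lemma class_CS m U F : class_C m.+1 U F -> class_C m U F.
Proof.
elim: m F => [|m IH] F /= [dF cF].
  by move=> u Uu; apply: differentiable_continuous; apply: dF.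
by split=> // k; apply: IH; apply: cF.
Qed.

Lemma class_C_subset m U W F : W `<=` U -> class_C m U F -> class_C m W F.
Proof.
move=> WU; elim: m F => [|m IH] F /=; first by move=> cF u /WU; apply: cF.
by move=> [dF cF]; split=> [u /WU/dF//|k]; apply: IH.
Qed.

Lemma class_C_cst m U (c : V) : class_C m U (fun=> c).
Proof.
elim: m c => [|m IH] c /=; first by move=> u _; apply: cst_continuous.
split=> [u _|k]; first exact: differentiable_cst.
have -> : partial k (fun _ : 'rV[R]_n => c) = fun=> 0.
  by apply/funext => u; exact: derive_cst.
exact: IH.
Qed.

End Directional.

Section Scalar.
Variables (R : realType) (n : nat).
Implicit Types (U : set 'rV[R]_n) (F G : 'rV[R]_n -> R^o).

Lemma class_C_coord m U p q (M : 'rV[R]_n -> 'M[R]_(p, q)) i j : open U ->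
  class_C m U M -> class_C m U (fun u => M u i j : R^o).
Proof.
move=> oU; elim: m M => [|m IH] M /=.
  move=> cM u Uu; apply: (@continuous_comp _ _ _ M (fun N => N i j)).
    exact: cM.
  exact: coord_continuous.
move=> [dM cM]; split=> [u Uu|k].
  apply: (differentiable_comp (f := M) (g := fun N : 'M[R]_(p,q) => N i j : R^o)).
    exact: dM.
  exact: differentiable_coord.
apply: eq_class_C oU _ (IH _ (cM k)) => u; rewrite inE => Uu.
rewrite /partial derive_mx ?mxE//.
exact/diff_derivable/dM.
Qed.

Lemma partialD k F G u : differentiable F u -> differentiable G u ->
  partial k (fun w => F w + G w : R^o) u = partial k F u + partial k G u.
Proof. by move=> dF dG; apply: deriveD; apply: diff_derivable. Qed.

Lemma partialM k F G u : differentiable F u -> differentiable G u ->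
  partial k (fun w => F w * G w : R^o) u
  = F u * partial k G u + G u * partial k F u.
Proof. by move=> dF dG; apply: deriveM; apply: diff_derivable. Qed.

Lemma partialN k F u : differentiable F u ->
  partial k (fun w => - F w : R^o) u = - partial k F u.
Proof. by move=> dF; apply: deriveN; apply: diff_derivable. Qed.

Lemma partial_sum p (F : 'I_p -> 'rV[R]_n -> R^o) k u :
  (forall i, differentiable (F i) u) ->
  partial k (fun w => \sum_i F i w : R^o) u = \sum_i partial k (F i) u.
Proof.
move=> dF; rewrite -[RHS]derive_sum.
  by congr (partial _ _ _); apply/funext => w; rewrite fct_sumE.
by move=> i; apply: diff_derivable.
Qed.

Lemma class_CD m U F G : open U -> class_C m U F -> class_C m U G ->
  class_C m U (fun u => F u + G u : R^o).
Proof.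
move=> oU; elim: m F G => [|m IH] F G /=.
  by move=> cF cG u Uu; apply: continuousD; [exact: cF|exact: cG].
move=> [dF cF] [dG cG]; split=> [u Uu|k].
  exact: differentiableD (dF u Uu) (dG u Uu).
apply: eq_class_C oU _ (IH _ _ (cF k) (cG k)) => u; rewrite inE => Uu.
by rewrite partialD//; [exact: dF|exact: dG].
Qed.

Lemma class_CM m U F G : open U -> class_C m U F -> class_C m U G ->
  class_C m U (fun u => F u * G u : R^o).
Proof.
move=> oU; elim: m F G => [|m IH] F G.
  by move=> cF cG u Uu; apply: continuousM; [exact: cF|exact: cG].
move=> sF sG; have [dF cF] := sF; have [dG cG] := sG; split=> [u Uu|k].
  exact: differentiableM (dF u Uu) (dG u Uu).
apply: eq_class_C oU _ (class_CD oU (IH _ _ (class_CS sF) (cG k))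
                                    (IH _ _ (class_CS sG) (cF k))) => u.
by rewrite inE => Uu; rewrite partialM//; [exact: dF|exact: dG].
Qed.

Lemma class_CV m U F : open U -> (forall u, U u -> F u != 0) ->
  class_C m U F -> class_C m U (fun u => (F u)^-1 : R^o).
Proof.
move=> oU F0; elim: m F F0 => [|m IH] F F0.
  by move=> cF u Uu; apply: continuousV; [exact: F0|exact: cF].
move=> sF; have [dF cF] := sF; split=> [u Uu|k].
  exact: differentiableV (dF u Uu) (F0 u Uu).
have sV := IH _ F0 (class_CS sF).
apply: eq_class_C oU _ (class_CM oU (class_CM oU sV sV)
  (class_CM oU (class_C_cst m U (-1 : R^o)) (cF k))) => u.
rewrite inE => Uu; rewrite /partial deriveV; last 2 first.
- exact: F0.
- exact/diff_derivable/dF.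
by rewrite mulN1r mulrN -expr2 exprVn scaleNr.
Qed.

Lemma differentiable_exp F u : differentiable F u ->
  differentiable (fun w => expR (F w) : R^o) u.
Proof.
move=> dF; apply: (differentiable_comp (f := F) (g := expR : R^o -> R^o)) => //.
exact/derivable1_diffP/derivable_expR.
Qed.

Lemma partial_exp F k u : differentiable F u ->
  partial k (fun w => expR (F w) : R^o) u = expR (F u) * partial k F u.
Proof.
move=> dF; rewrite /partial deriveE; last exact: differentiable_exp.
have dE : differentiable (expR : R^o -> R^o) (F u).
  exact/derivable1_diffP/derivable_expR.
rewrite (diff_comp (f := F) (g := expR : R^o -> R^o))//=.
rewrite deriv1E; last exact: derivable_expR.
rewrite (deriveE _ dF) /= mulrC; congr (_ * _); rewrite derive1E.
exact: (congr1 (fun f => f (F u)) (@derive_expR R)).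
Qed.

Lemma class_C_exp m U F : open U ->
  class_C m U F -> class_C m U (fun u => expR (F u) : R^o).
Proof.
move=> oU; elim: m F => [|m IH] F.
  move=> cF u Uu; apply: (@continuous_comp _ _ _ F (expR : R^o -> R^o)).
    exact: cF.
  exact: continuous_expR.
move=> sF; have [dF cF] := sF; split=> [u Uu|k].
  exact/differentiable_exp/dF.
apply: eq_class_C oU _ (class_CM oU (IH _ (class_CS sF)) (cF k)) => u.
by rewrite inE => Uu; rewrite partial_exp//; exact: dF.
Qed.

Lemma class_C_sum m U I (r : seq I) (P : pred I) (F : I -> 'rV[R]_n -> R^o) :
  open U -> (forall i, class_C m U (F i)) ->
  class_C m U (fun u => \sum_(i <- r | P i) F i u : R^o).
Proof.
move=> oU cF; elim: r => [|i r IH].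
  under eq_fun do rewrite big_nil; exact: class_C_cst.
under eq_fun do rewrite big_cons.
by case: (P i) => //; exact: class_CD.
Qed.

Lemma class_C_prod m U I (r : seq I) (P : pred I) (F : I -> 'rV[R]_n -> R^o) :
  open U -> (forall i, class_C m U (F i)) ->
  class_C m U (fun u => \prod_(i <- r | P i) F i u : R^o).
Proof.
move=> oU cF; elim: r => [|i r IH].
  under eq_fun do rewrite big_nil; exact: class_C_cst.
under eq_fun do rewrite big_cons.
by case: (P i) => //; exact: class_CM.
Qed.

Lemma class_C_det m U p (M : 'rV[R]_n -> 'M[R]_p) : open U ->
  (forall i j, class_C m U (fun u => M u i j : R^o)) ->
  class_C m U (fun u => \det (M u) : R^o).
Proof.
move=> oU cM; apply: class_C_sum => // s; apply: class_CM => //.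
  exact: class_C_cst.
exact: class_C_prod.
Qed.

End Scalar.

(** * Symmetry of second derivatives *)

Section Young.
Variables (R : realType) (W : normedModType R).
Implicit Types (U : set W) (p a b u : W).

Lemma is_derive_lineP (V : normedModType R) (F : W -> V) p a (t : R) (d : V) :
  is_derive t 1 (fun s : R => F (p + s *: a)) d <-> is_derive (p + t *: a) a F d.
Proof.
have E : (fun h : R => h^-1 *: (F (p + (h *: 1 + t) *: a) - F (p + t *: a)))
  = (fun h : R => h^-1 *: (F (h *: a + (p + t *: a)) - F (p + t *: a))).
  apply/funext => h; congr (_ *: (F _ - _)).
  by rewrite [h *: 1]mulr1 scalerDl addrCA.
split=> -[df <-]; split.
- by move: df; rewrite /derivable /= E.
- by rewrite /derive /= E.
- by rewrite /derivable /= E.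
- by rewrite /derive /= E.
Qed.

Lemma is_derive_line (V : normedModType R) (F : W -> V) p a (t : R) :
  differentiable F (p + t *: a) ->
  is_derive t 1 (fun s : R => F (p + s *: a)) ('D_a F (p + t *: a)).
Proof. by move=> dF; apply/is_derive_lineP; split=> //; exact/diff_derivable. Qed.

(** The second difference quotient along a and b tends to D_b D_a F: the mean
    value theorem along a reduces it to a first difference of D_a F, which is
    controlled by the differential of D_a F at u. *)
Lemma second_difference (F : W -> R^o) U u a b : open U -> U u ->
  (forall w, U w -> differentiable F w) -> differentiable ('D_a F) u ->
  forall e : R, 0 < e -> exists2 d : R, 0 < d & forall s : R, 0 < s -> s < d ->
   `|F (u + s *: a + s *: b) - F (u + s *: a) - F (u + s *: b) + F u
     - s ^+ 2 * 'D_b ('D_a F) u| <= e * s ^+ 2.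
Proof.
move=> oU Uu dF dG e e0; set G := 'D_a F.
(* s * N bounds the total size of the two displacements c a + s b and c a,
   for 0 <= c <= s, that occur at the mean value point c. *)
pose N : R := 2 * `|a| + `|b| + 1.
have N0 : 0 < N by rewrite /N ltr_wpDl// addr_ge0// mulr_ge0.
have [cd /eqaddoP oG] := (diff_locallyP u G).1 dG.
have /nbhs_ballP[r1 /= r10 br1] := open_nbhs_nbhs (conj oU Uu).
have /(_ (e / N)) := oG; rewrite divr_gt0// => /(_ isT) /nbhs_ballP[r2 /= r20 br2].
have inU h : `|h| < r1 -> U (u + h).
  by move=> hr; apply: br1; rewrite -ball_normE /= opprD addNKr normrN.
have estG h : `|h| < r2 -> `|G (u + h) - G u - 'd G u h| <= e / N * `|h|.
  move=> hr; have := br2 h; rewrite -ball_normE /= sub0r normrN => /(_ hr).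
  by rewrite !fctE/= opprD addrA (addrC h).
pose d : R := Num.min r1 r2 / N.
have d0 : 0 < d by rewrite divr_gt0// lt_min r10 r20.
exists d => // s s0 sd.
have sN : s * N < Num.min r1 r2 by rewrite -ltr_pdivlMr.
have sm c : 0 <= c -> c <= s -> `|c *: a + s *: b| <= s * N /\ `|c *: a| <= s * N /\
    `|c *: a + s *: b| + `|c *: a| <= s * N.
  move=> c0 cs; have ca : `|c *: a| <= s * `|a|.
    by rewrite normrZ ger0_norm// ler_wpM2r.
  have sb : `|s *: b| = s * `|b| by rewrite normrZ gtr0_norm.
  have := ler_normD (c *: a) (s *: b); rewrite sb /N.
  have := mulr_ge0 (ltW s0) (normr_ge0 a); have := mulr_ge0 (ltW s0) (normr_ge0 b).
  by move=> ? ? ?; split; [lra|split; lra].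
have smU c : 0 <= c -> c <= s -> U (u + s *: b + c *: a) /\ U (u + c *: a).
  move=> c0 cs; have [h1 [h2 _]] := sm c c0 cs.
  split; rewrite -?addrA; apply: inU.
    by rewrite addrC; apply: (le_lt_trans h1); move: sN; rewrite lt_min => /andP[].
  by apply: (le_lt_trans h2); move: sN; rewrite lt_min => /andP[].
pose g := fun t : R => (F (u + s *: b + t *: a) - F (u + t *: a)) : R^o.
have dg c : 0 <= c -> c <= s ->
    is_derive c 1 g (G (u + s *: b + c *: a) - G (u + c *: a)).
  move=> c0 cs; have [U1 U2] := smU c c0 cs.
  by apply: is_deriveB; apply: is_derive_line; apply: dF.
have [||c] := @MVT R g (fun c => G (u + s *: b + c *: a) - G (u + c *: a)) 0 s s0.
- by move=> c; rewrite in_itv /= => /andP[c0 cs]; apply: dg; exact: ltW.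
- apply: derivable_within_continuous => c; rewrite in_itv /= => /andP[c0 cs].
  by have [] := dg c c0 cs.
rewrite in_itv /= => /andP[/ltW c0 /ltW cs].
have [h1 [h2 h3]] := sm c c0 cs.
have [l1 l2] : `|c *: a + s *: b| < r2 /\ `|c *: a| < r2.
  by move: sN; rewrite lt_min => /andP[_ sN]; split; exact: le_lt_trans sN.
have Ex t t' : u + t *: b + t' *: a = u + (t' *: a + t *: b).
  by rewrite -addrA (addrC (t *: b)).
rewrite subr0 /g !Ex scale0r addr0 add0r => gE.
have -> : F (u + s *: a + s *: b) - F (u + s *: a) - F (u + s *: b) + F u =
  (G (u + (c *: a + s *: b)) - G (u + c *: a)) * s.
  rewrite -gE -(addrA u); lra.
have E1 := estG _ l1; have E2 := estG _ l2.
have Lin : 'd G u (c *: a + s *: b) = 'd G u (c *: a) + s * 'd G u b.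
  by rewrite linearD; congr (_ + _); rewrite linearZ.
rewrite Lin in E1.
rewrite (deriveE _ dG).
set x1 := G _ in E1 *; set x2 := G _ in E2 *.
set A := 'd G u (c *: a) in E1 E2; set B := 'd G u b in E1 *.
have -> : (x1 - x2) * s - s ^+ 2 * B =
    s * ((x1 - G u - (A + s * B)) - (x2 - G u - A)) by ring.
rewrite normrM (gtr0_norm s0) expr2 mulrCA ler_pM2l//.
apply: (le_trans (ler_normB _ _)); apply: (le_trans (lerD E1 E2)).
rewrite -mulrDr -ler_pdivlMl ?divr_gt0//; apply: (le_trans h3).
by rewrite invf_div mulrA divfK ?gt_eqF// mulrC.
Qed.

(** Only the differentiability of both first derivatives at u is needed; their
    continuity is not. *)
Lemma young (F : W -> R^o) U u a b : open U -> U u ->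
  (forall w, U w -> differentiable F w) ->
  differentiable ('D_a F) u -> differentiable ('D_b F) u ->
  'D_b ('D_a F) u = 'D_a ('D_b F) u.
Proof.
move=> oU Uu dF da db; apply/eqP; rewrite -subr_eq0; apply/eqP/normr0_eq0.
apply/eqP; rewrite eq_le normr_ge0 andbT; apply/ler_addgt0Pl => e e0.
rewrite addr0.
have e2 : 0 < e / 2 by rewrite divr_gt0.
have [d1 d10 H1] := second_difference b oU Uu dF da e2.
have [d2 d20 H2] := second_difference a oU Uu dF db e2.
pose s := Num.min d1 d2 / 2.
have s0 : 0 < s by rewrite divr_gt0// lt_min d10 d20.
have [s1 s2] : s < d1 /\ s < d2.
  have : s < Num.min d1 d2 by rewrite /s; move: s0; rewrite /s; lra.
  by rewrite lt_min => /andP.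
have := H1 s s0 s1; have := H2 s s0 s2.
have -> : u + s *: b + s *: a = u + s *: a + s *: b by rewrite addrAC.
move: (F (u + s *: a + s *: b)) (F (u + s *: b)) (F (u + s *: a)) (F u)
  ('D_b ('D_a F) u) ('D_a ('D_b F) u) => X X1 X2 X3 P Q K2 K1.
have s20 : 0 < s ^+ 2 by rewrite exprn_gt0.
rewrite -(ler_pM2r s20) -[in leLHS](gtr0_norm s20) -normrM.
have -> : (P - Q) * s ^+ 2 =
    (X - X1 - X2 + X3 - s ^+ 2 * Q) - (X - X2 - X1 + X3 - s ^+ 2 * P) by ring.
apply: (le_trans (ler_normB _ _)); apply: (le_trans (lerD K2 K1)).
by rewrite -mulrDl -splitr.
Qed.

End Young.

(** * Integrals over the unit interval and restriction to lines *)

Section UnitInterval.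
Variable R : realType.
Notation mu := (@lebesgue_measure R).

(** Differentiation at 0 of an integral over [0, 1] depending on a parameter,
    the partial derivative being uniformly bounded for small parameters. *)
Lemma is_derive_integral01 (f df : R -> R -> R) (d M : R) : 0 < d ->
  (forall s t : R, `|s| < d -> t \in `[0, 1] ->
     is_derive s 1 (f ^~ t) (df s t) /\ `|df s t| <= M) ->
  (forall s : R, `|s| < d -> {within `[0, 1], continuous (f s)}) ->
  is_derive (0 : R) 1 (fun s => \int[mu]_(t in `[0, 1]) f s t)
    (\int[mu]_(t in `[0, 1]) df 0 t).
Proof.
move=> d0 fdf cf.
have sd (s : R) : `]- d, d[%classic s -> `|s| < d.
  by rewrite /= in_itv /= ltr_norml.
have d1E s t : `|s| < d -> t \in `[0, 1] -> partial1of2 f s t = df s t.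
  by move=> sd' t01; rewrite partial1of2E; have [[_ ->] _] := fdf s t sd' t01.
have I0 : `]- d, d[%classic (0 : R) by rewrite /= in_itv /= oppr_lt0 d0.
have n0 : `|0 : R| < d by rewrite normr0.
have M0 : 0 <= M.
  have [|_] := fdf 0 0 n0; first by rewrite in_itv /= lexx ler01.
  exact: le_trans.
have mB : measurable (`[0, 1] : set (measurableTypeR R)) by [].
have i1 s : `]- d, d[%classic s -> mu.-integrable `[0, 1] (EFin \o f s).
  move=> /sd sd'; apply: continuous_compact_integrable; last exact: cf.
  exact: segment_compact.
have i2 s t : `]- d, d[%classic s -> `[0, 1]%classic t -> derivable (f ^~ t) s 1.
  by move=> /sd sd' t01; have [[]] := fdf s t sd' t01.
have i3 : mu.-integrable `[0, 1] (EFin \o (fun=> M)).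
  apply: continuous_compact_integrable; first exact: segment_compact.
  by apply: continuous_subspaceT; exact: cst_continuous.
have i4 s t : `]- d, d[%classic s -> `[0, 1]%classic t ->
    `|partial1of2 f s t| <= (fun=> M) t.
  by move=> /sd sd' t01; rewrite d1E//; have [] := fdf s t sd' t01.
split.
  exact: (derivable_under_integral mB I0 i1 i2 _ i3 i4).
rewrite -derive1E (differentiation_under_integral mB I0 i1 i2 _ i3 i4)//.
by apply: eq_Rintegral => t; rewrite inE => t01; rewrite d1E.
Qed.

Lemma integral01_derive (F f : R -> R) :
  (forall t : R, t \in `[0, 1] -> is_derive t 1 F (f t)) ->
  (forall t : R, t \in `[0, 1] -> {for t, continuous f}) ->
  \int[mu]_(t in `[0, 1]) f t = F 1 - F 0.
Proof.
move=> dF cf; rewrite /Rintegral (@continuous_FTC2 _ f F) ?ltr01//.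
- by apply: continuous_in_subspaceT => t; rewrite inE; apply: cf.
- have cF (t : R) : t \in `[0, 1] -> {for t, continuous F}.
    by move=> t01; apply/differentiable_continuous/derivable1_diffP; have [] := dF t t01.
  split=> [t t01||].
  + by have [] := dF t (subset_itv_oo_cc t01).
  + by apply: cvg_at_right_filter; apply: cF; rewrite in_itv /= lexx ler01.
  + by apply: cvg_at_left_filter; apply: cF; rewrite in_itv /= lexx ler01.
- by move=> t t01; rewrite derive1E; have [_ ->] := dF t (subset_itv_oo_cc t01).
Qed.

End UnitInterval.

Section Line.
Variable R : realType.

Lemma continuous_line (W V : normedModType R) (F : W -> V) (p a : W) (t : R) :
  {for p + t *: a, continuous F} -> {for t, continuous (fun s : R => F (p + s *: a))}.
Proof.
move=> cF; apply: (@continuous_comp _ _ _ (fun s : R => p + s *: a) F) => //.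
apply: differentiable_continuous; apply/derivable1_diffP.
have dI : differentiable (@id W) (p + t *: a) by [].
by have [] := is_derive_line dI.
Qed.

Lemma is_derive_fsum n (G : 'I_n -> R -> R^o) (dG : 'I_n -> R^o) (t : R) :
  (forall k, is_derive t 1 (G k) (dG k)) ->
  is_derive t 1 (fun s : R => \sum_k G k s : R^o) (\sum_k dG k).
Proof.
move=> dGk; have -> : (fun s : R => \sum_k G k s : R^o) = \sum_k G k.
  by apply/funext => s; rewrite fct_sumE.
exact: is_derive_sum.
Qed.

Lemma is_derive_fscale (c : R) (G : R -> R^o) (dG : R^o) (t : R) :
  is_derive t 1 G dG -> is_derive t 1 (fun s : R => c * G s : R^o) (c * dG).
Proof. by move=> dGt; exact: is_deriveZ. Qed.

Lemma is_derive_fmul (F G : R -> R^o) (dF dG : R^o) (t : R) :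
  is_derive t 1 F dF -> is_derive t 1 G dG ->
  is_derive t 1 (fun s : R => F s * G s : R^o) (dF * G t + F t * dG).
Proof.
move=> dFt dGt; apply: (is_derive_eq (is_deriveM dFt dGt)).
by rewrite addrC [X in X + _ = _]mulrC.
Qed.

Lemma continuous_fsum n (G : 'I_n -> R -> R^o) (t : R) :
  (forall k, {for t, continuous (G k)}) ->
  {for t, continuous (fun s : R => \sum_k G k s : R^o)}.
Proof.
elim: n G => [|n IH] G cG.
  have -> : (fun s : R => \sum_k G k s : R^o) = fun=> 0.
    by apply/funext => s; rewrite big_ord0.
  exact: cst_continuous.
have -> : (fun s : R => \sum_k G k s : R^o) =
    (fun s => G ord0 s + \sum_k G (lift ord0 k) s).
  by apply/funext => s; rewrite big_ord_recl.
by apply: continuousD; [exact: cG|apply: IH].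
Qed.

Lemma continuous_fmul (F G : R -> R^o) (t : R) :
  {for t, continuous F} -> {for t, continuous G} ->
  {for t, continuous (fun s : R => F s * G s : R^o)}.
Proof. by move=> cF cG; exact: continuousM. Qed.

Lemma continuous_fscale c (F : R -> R^o) (t : R) :
  {for t, continuous F} -> {for t, continuous (fun s : R => c * F s : R^o)}.
Proof. by move=> cF; apply: continuous_fmul => //; exact: cst_continuous. Qed.

End Line.

(** * The Poincare lemma on a ball *)

Section Poincare.
Variables (R : realType) (n : nat).
Implicit Types (u w p x : 'rV[R]_n).
Notation mu := (@lebesgue_measure R).

Lemma coord_le_norm x k : `|x 0 k| <= `|x|.
Proof.
rewrite [leRHS]/Num.Def.normr/= mx_normrE.
by rewrite (le_trans _ (le_bigmax _ _ (0, k))).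
Qed.

(** The bound that dominates the derivative of the integrand of
    [ray_primitive] below. *)
Lemma ler_norm_chain (w y a m : 'I_n -> R) (b m' : 'I_n -> 'I_n -> R) (t r : R) :
  0 <= t -> t <= 1 -> (forall k, `|a k| <= m k) -> (forall k, `|y k| <= r) ->
  (forall k l, `|b k l| <= m' k l) ->
  `|\sum_k (w k * a k + y k * (t * \sum_l w l * b k l))| <=
  \sum_k (`|w k| * m k + r * \sum_l `|w l| * m' k l).
Proof.
move=> t0 t1 am yr bm.
apply: (le_trans (ler_norm_sum _ _ _)); apply: ler_sum => k _.
apply: (le_trans (ler_normD _ _)); rewrite !normrM; apply: lerD.
  exact: ler_wpM2l.
have tS : `|t| * `|\sum_l w l * b k l| <= \sum_l `|w l| * m' k l.
  rewrite ger0_norm//; apply: (@le_trans _ _ `|\sum_l w l * b k l|).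
    by rewrite ler_piMl.
  apply: (le_trans (ler_norm_sum _ _ _)); apply: ler_sum => l _.
  by rewrite normrM ler_wpM2l.
by apply: ler_pM => //; rewrite mulr_ge0.
Qed.

Lemma continuous_bounded_ball (F : 'rV[R]_n -> R^o) u (e r : R) : 0 <= r -> r < e ->
  (forall p, ball u e p -> {for p, continuous F}) ->
  exists M : R, forall p, `|p - u| <= r -> `|F p| <= M.
Proof.
move=> r0 re cF; pose K := [set p | `|p - u| <= r].
have cK : compact K.
  apply: bounded_closed_compact.
    exists (`|u| + r); split; first by rewrite realE addr_ge0.
    move=> M uM p Kp; apply: (le_trans _ (ltW uM)).
    have : `|p - u + u| <= `|p - u| + `|u| := ler_normD _ _.
    by rewrite subrK addrC => /le_trans; apply; rewrite lerD2l.
  rewrite (_ : K = closed_ball_ (fun p => `|p|) u r); first exact: closed_closed_ball_.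
  by apply/seteqP; split=> p; rewrite /K /closed_ball_ /= distrC.
have [||c _ Hc] := @EVT_max_rV R n (fun p => `|F p|) K _ cK.
- by exists u; rewrite /K /= subrr normr0.
- apply: continuous_in_subspaceT => p; rewrite inE /K /= => Kp.
  apply: (@continuous_comp _ _ _ F (fun y : R^o => `|y|)).
    by apply: cF; rewrite -ball_normE /= distrC (le_lt_trans Kp).
  exact: norm_continuous.
by exists `|F c| => p Kp; apply: Hc; rewrite inE.
Qed.

Variables (alpha : 'I_n -> 'rV[R]_n -> R^o) (u0 : 'rV[R]_n) (e : R).
Hypothesis alpha_C1 : forall k, class_C 1 (ball u0 e) (alpha k).
Hypothesis alpha_closed : forall u, ball u0 e u -> forall k l,
  partial l (alpha k) u = partial k (alpha l) u.

Let dalpha k u : ball u0 e u -> differentiable (alpha k) u.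
Proof. by have [dA _] := alpha_C1 k; apply: dA. Qed.

Let cdalpha k l u : ball u0 e u -> {for u, continuous (partial l (alpha k))}.
Proof. by have [_ /(_ l)] := alpha_C1 k; apply. Qed.

(** The integral of alpha along the segment from u0 to u. *)
Definition ray_primitive u : R^o :=
  \int[mu]_(t in `[0, 1]) \sum_k (u - u0) 0 k * alpha k (u0 + t *: (u - u0)).

Let ballE p : ball u0 e p = (`|p - u0| < e) :> Prop.
Proof. by rewrite -ball_normE /= distrC. Qed.

Lemma is_derive_ray_primitive u w : ball u0 e u ->
  is_derive (0 : R) 1 (fun s : R => ray_primitive (u + s *: w))
    (\sum_k w 0 k * alpha k u).
Proof.
move=> Bu; pose x := u - u0.
have xe : `|x| < e by rewrite -ballE.
(* For |s| < d, every segment from u0 to u + s w stays in the closed ball of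
   radius r < e, where compactness bounds alpha and its derivatives. *)
pose r := (`|x| + e) / 2.
have r0 : 0 <= r by rewrite divr_ge0// addr_ge0// (le_trans _ (ltW xe)).
have re : r < e by rewrite /r; lra.
pose d := (e - `|x|) / 2 / (`|w| + 1).
have w1 : 0 < `|w| + 1 by rewrite ltr_wpDl.
have d0 : 0 < d by rewrite !divr_gt0// subr_gt0.
have dw : d * `|w| <= (e - `|x|) / 2.
  rewrite /d -mulrA ler_piMr//; first by rewrite divr_ge0// subr_ge0 ltW.
  by rewrite mulrC ler_pdivrMr// mul1r lerDl.
have xs s : `|s| < d -> `|x + s *: w| <= r.
  move=> sd; apply: (le_trans (ler_normD _ _)); rewrite normrZ.
  have : `|s| * `|w| <= d * `|w| by rewrite ler_wpM2r// ltW.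
  by rewrite /r; lra.
have tx (s t : R) : `|s| < d -> t \in `[0, 1] -> `|t *: (x + s *: w)| <= r.
  rewrite in_itv /= => sd /andP[t0 t1]; rewrite normrZ ger0_norm//.
  by apply: (le_trans _ (xs s sd)); rewrite ler_piMl.
have Bt s t : `|s| < d -> t \in `[0, 1] -> ball u0 e (u0 + t *: (x + s *: w)).
  by move=> sd t01; rewrite ballE addrC addKr (le_lt_trans (tx s t sd t01)).
have /choice[m Hm] : forall k, exists M : R, forall p, `|p - u0| <= r ->
    `|alpha k p| <= M.
  move=> k; apply: continuous_bounded_ball r0 re _ => p Bp.
  exact/differentiable_continuous/dalpha.
have /choice[m' Hm'] : forall kl, exists M : R, forall p, `|p - u0| <= r ->
    `|partial kl.2 (alpha kl.1) p| <= M.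
  by move=> [k l]; apply: continuous_bounded_ball r0 re _ => p Bp; exact: cdalpha.
pose f (s t : R) := \sum_k (x + s *: w) 0 k * alpha k (u0 + t *: (x + s *: w)).
pose df (s t : R) := \sum_k (w 0 k * alpha k (u0 + t *: (x + s *: w)) +
   (x + s *: w) 0 k * (t * \sum_l w 0 l * partial l (alpha k) (u0 + t *: (x + s *: w)))).
pose M := \sum_k (`|w 0 k| * m k + r * \sum_l (`|w 0 l| * m' (k, l))).
have fE : (fun s : R => ray_primitive (u + s *: w)) =
    (fun s => \int[mu]_(t in `[0, 1]) f s t).
  by apply/funext => s; rewrite /ray_primitive addrAC.
have dfE (s t : R) : `|s| < d -> t \in `[0, 1] -> is_derive s 1 (f ^~ t) (df s t).
  move=> sd t01; have Bp := Bt s t sd t01.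
  apply: is_derive_fsum => k.
  have d1 : is_derive s 1 (fun s : R => (x + s *: w) 0 k : R^o) (w 0 k : R^o).
    have -> : (fun s : R => (x + s *: w) 0 k : R^o) =
        (fun s : R => (x 0 k + s *: w 0 k : R^o)).
      by apply/funext => s'; rewrite !mxE.
    by apply: (is_derive_eq (is_derive_line (F := @id R^o) _)) => //; rewrite derive_id.
  have Ep (s' : R) : u0 + t *: (x + s' *: w) = (u0 + t *: x) + s' *: (t *: w).
    by rewrite scalerDr !scalerA mulrC addrA.
  have d2 : is_derive s 1 (fun s : R => alpha k (u0 + t *: (x + s *: w)))
      (t * \sum_l w 0 l * partial l (alpha k) (u0 + t *: (x + s *: w))).
    have -> : (fun s : R => alpha k (u0 + t *: (x + s *: w))) =
      (fun s : R => alpha k ((u0 + t *: x) + s *: (t *: w))).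
      by apply/funext => s'; rewrite Ep.
    have dA : differentiable (alpha k) ((u0 + t *: x) + s *: (t *: w)).
      by rewrite -Ep; apply: dalpha.
    apply: (is_derive_eq (is_derive_line dA)).
    rewrite derive_sum_partial// -Ep mulr_sumr; apply: eq_bigr => l _.
    by rewrite !mxE mulrA.
  exact: is_derive_fmul d1 d2.
have dfM (s t : R) : `|s| < d -> t \in `[0, 1] -> `|df s t| <= M.
  move=> sd t01; have pr := tx s t sd t01.
  have {}pr : `|u0 + t *: (x + s *: w) - u0| <= r by rewrite addrC addKr.
  have [t0 t1] : 0 <= t /\ t <= 1 by move: t01; rewrite in_itv => /andP.
  apply: ler_norm_chain => // [k|k|k l].
  - exact: Hm.
  - exact: le_trans (coord_le_norm _ _) (xs s sd).
  - exact: (Hm' (k, l)).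
have cf (s : R) : `|s| < d -> {within `[0, 1], continuous (f s)}.
  move=> sd; apply: continuous_in_subspaceT => t; rewrite inE => t01.
  apply: continuous_fsum => k; apply: continuous_fscale.
  by apply: continuous_line; apply/differentiable_continuous/dalpha/Bt.
have := is_derive_integral01 d0
  (fun s t sd t01 => conj (dfE s t sd t01) (dfM s t sd t01)) cf.
rewrite -fE => D0; apply: (is_derive_eq D0).
have n0 : `|0 : R| < d by rewrite normr0.
(* Since alpha is closed, the integrand df 0 is the derivative of H. *)
pose H (t : R) := t * \sum_k w 0 k * alpha k (u0 + t *: x).
have Bt0 t : t \in `[0, 1] -> ball u0 e (u0 + t *: x).
  by move=> t01; have := Bt 0 t n0 t01; rewrite scale0r addr0.
have df0 t : t \in `[0, 1] -> df 0 t = \sum_k w 0 k * alpha k (u0 + t *: x) +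
   t * \sum_k w 0 k * (\sum_l x 0 l * partial l (alpha k) (u0 + t *: x)).
  move=> t01; rewrite /df scale0r addr0 big_split /=; congr (_ + _).
  under eq_bigr do rewrite mulrCA; rewrite -mulr_sumr; congr (_ * _).
  under eq_bigr do rewrite mulr_sumr.
  rewrite exchange_big /=; apply: eq_bigr => k _; rewrite mulr_sumr.
  apply: eq_bigr => l _.
  by rewrite mulrCA alpha_closed//; exact: Bt0.
have -> : \sum_k w 0 k * alpha k u = H 1 - H 0.
  by rewrite /H mul1r mul0r subr0 scale1r /x addrC subrK.
apply: integral01_derive.
- move=> t t01; rewrite (df0 t t01).
  have dA k : differentiable (alpha k) (u0 + t *: x) by apply/dalpha/Bt0.
  have d2 : is_derive t 1 (fun t : R => \sum_k w 0 k * alpha k (u0 + t *: x))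
    (\sum_k w 0 k * (\sum_l x 0 l * partial l (alpha k) (u0 + t *: x))).
    apply: is_derive_fsum => k; rewrite -derive_sum_partial//.
    by apply: is_derive_fscale; apply: is_derive_line.
  apply: (is_derive_eq (is_derive_fmul (is_derive_id t 1) d2)).
  by rewrite mul1r.
- move=> t t01; apply: continuous_fsum => k; apply: continuousD.
    by apply/continuous_fscale/continuous_line/differentiable_continuous/dalpha/Bt.
  apply/continuous_fscale/continuous_fmul; first exact: cvg_id.
  apply: continuous_fsum => l; apply/continuous_fscale/continuous_line.
  exact/cdalpha/Bt.
Qed.

End Poincare.

Section Gradient.
Variables (R : realType) (n : nat).
Implicit Types (u w p x : 'rV[R]_n).

(** The value at the vector h of the linear form with coefficients c. *)
Definition pairing (c : 'I_n -> R) (h : 'rV[R]_n) : R^o := \sum_k h 0 k * c k.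

Lemma pairing_is_linear c : linear (pairing c).
Proof.
move=> a x y; rewrite /pairing scaler_sumr -big_split /=; apply: eq_bigr => k _.
by rewrite !mxE mulrDl -mulrA.
Qed.

HB.instance Definition _ c :=
  GRing.isLinear.Build R 'rV[R]_n R^o _ (pairing c) (pairing_is_linear c).

Lemma pairing_continuous c : continuous (pairing c).
Proof.
have -> : pairing c = (fun h => \sum_k h 0 k * c k) by [].
move=> h; apply: (@differentiable_continuous R 'rV[R]_n R^o).
have -> : (fun h : 'rV[R]_n => \sum_k h 0 k * c k : R^o) =
    \sum_k (fun h : 'rV[R]_n => h 0 k * c k : R^o).
  by apply/funext => s; rewrite fct_sumE.
apply: differentiable_sum => k; apply: differentiableM => //.
exact: differentiable_coord.
Qed.

(** A function whose directional derivatives are given by continuous linear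
    forms is differentiable: apply the mean value theorem on the segment from
    u to u + h. *)
Lemma differentiable_of_directional (F : 'rV[R]_n -> R^o) U
    (c : 'I_n -> 'rV[R]_n -> R^o) u : open U -> U u ->
  (forall k, {for u, continuous (c k)}) ->
  (forall p w, U p -> is_derive p w F (pairing (c^~ p) w)) ->
  differentiable F u.
Proof.
move=> oU Uu cc dF.
apply: (differentiable_eps (L := pairing (c^~ u))).
  exact: pairing_continuous.
move=> e e0; pose N : R := n%:R + 1.
have N0 : 0 < N by rewrite ltr_wpDl.
have near_u : \forall p \near u, U p /\ forall k, `|c k p - c k u| <= e / N.
  apply: filterI; first exact: open_nbhs_nbhs.
  have ck k : \forall p \near u, `|c k p - c k u| <= e / N.
    near=> p; rewrite distrC; near: p.
    by have /cvgrPdist_le := cc k; apply; exact: divr_gt0.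
  exact: filter_forall ck.
have /nbhs_ballP[r /= r0 br] := near_u.
near=> h.
have hr : `|h| < r.
  near: h; apply/nbhs_ballP; exists r => // h.
  by rewrite -ball_normE /= sub0r normrN.
have seg (t : R) : 0 <= t -> t <= 1 ->
    U (u + t *: h) /\ forall k, `|c k (u + t *: h) - c k u| <= e / N.
  move=> t0 t1; apply: br; rewrite -ball_normE /= opprD addNKr normrN normrZ.
  by rewrite ger0_norm// (le_lt_trans _ hr)// ler_piMl.
have dg (t : R) : 0 <= t -> t <= 1 ->
    is_derive t 1 (fun s : R => F (u + s *: h)) (pairing (c^~ (u + t *: h)) h).
  by move=> t0 t1; apply/is_derive_lineP/dF; have [] := seg t t0 t1.
have [||t] := @MVT R (fun s : R => F (u + s *: h))
    (fun t => pairing (c^~ (u + t *: h)) h) 0 1 ltr01.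
- by move=> t; rewrite in_itv /= => /andP[t0 t1]; apply: dg; exact: ltW.
- apply: derivable_within_continuous => t; rewrite in_itv /= => /andP[t0 t1].
  by have [] := dg t t0 t1.
rewrite in_itv /= => /andP[/ltW t0 /ltW t1].
rewrite scale1r scale0r addr0 subr0 mulr1 => FE; rewrite [h + u]addrC FE.
rewrite /pairing -sumrB; apply: (le_trans (ler_norm_sum _ _ _)).
apply: (@le_trans _ _ (\sum_(k < n) (`|h| * (e / N)))).
  apply: ler_sum => k _; rewrite -mulrBr normrM; apply: ler_pM => //.
    exact: coord_le_norm.
  by have [_] := seg t t0 t1; apply.
rewrite sumr_const card_ord -mulr_natr -mulrA [leRHS]mulrC ler_wpM2l//.
by rewrite mulrAC ler_pdivrMr// ler_pM2l// lerDl.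
Unshelve. all: by end_near. Qed.

(** The ray primitive works since a ball is star-shaped about its centre. *)
Lemma poincare (alpha : 'I_n -> 'rV[R]_n -> R^o) (u0 : 'rV[R]_n) (e : R) :
  (forall k, class_C 1 (ball u0 e) (alpha k)) ->
  (forall u, ball u0 e u -> forall k l,
     partial l (alpha k) u = partial k (alpha l) u) ->
  exists psi : 'rV[R]_n -> R^o, forall u, ball u0 e u ->
    differentiable psi u /\ forall k, partial k psi u = alpha k u.
Proof.
move=> aC1 acl; exists (ray_primitive alpha u0) => u Bu.
have dP p w : ball u0 e p ->
    is_derive p w (ray_primitive alpha u0) (pairing (alpha^~ p) w).
  move=> Bp; have := is_derive_ray_primitive aC1 acl w Bp.
  by move/is_derive_lineP; rewrite scale0r addr0.
split=> [|k].
  apply: (differentiable_of_directional (ball_open u0 e) Bu _ dP) => k.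
  by apply: differentiable_continuous; have [dA _] := aC1 k; apply: dA.
have [_ ] := dP u (delta_mx 0 k) Bu; rewrite /partial => ->.
rewrite /pairing (bigD1 k)//= mxE !eqxx mul1r big1 ?addr0// => l lk.
by rewrite mxE eqxx (negbTE lk) mul0r.
Qed.

End Gradient.

(** * Linear algebra of eigenvectors *)

Section LinearAlgebra.
Variable R : realType.

(** Eigenvectors for distinct eigenvalues are independent: the eigenspaces
    are in direct sum, so each of them is spanned by the given eigenvector. *)
Lemma row_free_eigenvectors n (g : 'M[R]_n) (X : 'M[R]_n) (a : 'I_n -> R) :
  injective a -> (forall i, row i X != 0) ->
  (forall i, row i X *m g = a i *: row i X) -> X \in unitmx.
Proof.
move=> inja X0 Xg; rewrite -row_full_unit.
pose E i := eigenspace g (a i).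
have XE i : (row i X <= E i)%MS by apply/eigenspaceP.
have rX i : \rank (row i X) = 1%N by rewrite rank_rV X0.
have dE : mxdirect (\sum_i E i)%MS.
  by apply: mxdirect_sum_eigenspace => i j _ _; exact: inja.
have rE0 i : (1 <= \rank (E i))%N by rewrite -(rX i); exact: mxrankS.
have rE i : (1 <= \rank (E i) ?= iff (\rank (E i) <= 1))%N.
  exact: leqif_geq (rE0 i).
have sE := leqif_sum (fun i (_ : true) => rE i).
have /= sE' := mxdirectP dE; rewrite sum1_card card_ord in sE.
have : (\sum_i \rank (E i) <= n)%N by rewrite -sE' rank_leq_col.
rewrite (geq_leqif sE) => /forallP rE1.
have EX i : (E i <= X)%MS.
  apply: (submx_trans _ (row_sub i X)).
  have [_ <-] := mxrank_leqif_sup (XE i); rewrite rX eqn_leq.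
  by rewrite rE0; exact: (implyP (rE1 i)).
rewrite -sub1mx; have sEX : (\sum_i E i <= X)%MS by apply/sumsmx_subP.
apply: submx_trans sEX; rewrite sub1mx /row_full sE'.
by rewrite eqn_leq -[X in (X <= n)%N]sE' rank_leq_col; case: sE.
Qed.

Lemma submx_annihilator n (T : 'M[R]_(n, 1 + n)) (A : 'cV[R]_(1 + n))
    (X : 'rV[R]_(1 + n)) : \rank T = n -> A != 0 -> T *m A = 0 ->
  (X <= T)%MS <-> X *m A = 0.
Proof.
move=> rT A0 TA; split=> [/submxP[D ->]|XA]; first by rewrite -mulmxA TA mulmx0.
have TK : (T <= kermx A)%MS by apply/sub_kermxP.
have rA : (0 < \rank A)%N by rewrite lt0n mxrank_eq0.
have rK : (\rank (kermx A) <= n)%N by rewrite mxrank_ker leq_subLR leq_add2r.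
apply: submx_trans (_ : (kermx A <= T)%MS); first exact/sub_kermxP.
by have [_ <-] := mxrank_leqif_sup TK; rewrite eqn_leq mxrankS//= rT.
Qed.

(** A bilinear form which is diagonal in some basis is symmetric. *)
Lemma congr_sym n (X Q : 'M[R]_n) : X \in unitmx ->
  (forall i j, i != j -> (X *m Q *m X^T) i j = 0) -> Q^T = Q.
Proof.
move=> uX G0; pose G := X *m Q *m X^T.
have GT : G^T = G.
  apply/matrixP => i j; rewrite mxE.
  by have [->//|ij] := eqVneq i j; rewrite /G !G0// eq_sym.
have uXT : X^T \in unitmx by rewrite unitmx_tr.
have QE : Q = invmx X *m G *m invmx X^T.
  by rewrite /G !mulmxA mulVmx// mul1mx mulmxK.
by clearbody G; rewrite QE !trmx_mul GT !trmx_inv trmxK mulmxA.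
Qed.

(** If H and H v are symmetric then v is self-adjoint for H, hence its
    eigenvectors for distinct eigenvalues are H-orthogonal. *)
Lemma orth_eigen n (H v : 'M[R]_n) (x y : 'cV[R]_n) (a b : R) :
  H^T = H -> (H *m v)^T = H *m v -> v *m x = a *: x -> v *m y = b *: y ->
  a != b -> x^T *m H *m y = 0.
Proof.
move=> HT HvT vx vy ab.
have E1 : x^T *m (H *m v) *m y = b *: (x^T *m H *m y).
  by rewrite -!mulmxA vy -!scalemxAr.
have E2 : x^T *m (H *m v) *m y = a *: (x^T *m H *m y).
  rewrite -HvT trmx_mul HT !mulmxA -trmx_mul vx linearZ /=.
  by rewrite -!scalemxAl.
apply/eqP; move/eqP: E1; rewrite E2 -subr_eq0 -scalerBl scaler_eq0.
by rewrite subr_eq0 (negbTE ab).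
Qed.

Lemma unitmx_shift n (v : 'M[R]_n) (X : 'M[R]_n) (a : 'I_n -> R) (p : R) :
  X \in unitmx -> (forall i, row i X *m v^T = a i *: row i X) ->
  (forall i, p != a i) -> p%:M - v \in unitmx.
Proof.
move=> uX Xv pa; rewrite -unitmx_tr.
have E : X *m (p%:M - v)^T = diag_mx (\row_i (p - a i)) *m X.
  apply/row_matrixP => i; rewrite !row_mul linearB /= tr_scalar_mx mulmxBr.
  rewrite mul_mx_scalar Xv -scalerBl row_diag_mx mxE -scalemxAl -rowE.
  by [].
have : X *m (p%:M - v)^T \in unitmx.
  rewrite E unitmx_mul uX andbT unitmxE det_diag unitfE; apply/prodf_neq0 => i _.
  by rewrite mxE subr_eq0.
by rewrite unitmx_mul => /andP[].
Qed.

End LinearAlgebra.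

(** * Smooth functions *)

Section Smooth.
Variables (R : realType) (n : nat) (V : normedModType R).
Implicit Types (U : set 'rV[R]_n) (F : 'rV[R]_n -> V).

Lemma smooth_differentiable U F u : smooth_on U F -> U u -> differentiable F u.
Proof. by move=> sF Uu; have [dF _] := sF 1%N; apply: dF. Qed.

Lemma smooth_partial U F k : smooth_on U F -> smooth_on U (partial k F).
Proof. by move=> sF m; have [_ pF] := sF m.+1; apply: pF. Qed.

Lemma smooth_subset U W F : W `<=` U -> smooth_on U F -> smooth_on W F.
Proof. by move=> WU sF m; apply: class_C_subset WU (sF m). Qed.

End Smooth.

Section SmoothScalar.
Variables (R : realType) (n : nat).
Implicit Types (U : set 'rV[R]_n) (F : 'rV[R]_n -> R^o).

(** Each differentiation lands on the coefficients of dF = alpha, so F is as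
    smooth as alpha. *)
Lemma smooth_primitive U F (alpha : 'I_n -> 'rV[R]_n -> R^o) : open U ->
  (forall k, smooth_on U (alpha k)) ->
  (forall u, U u -> differentiable F u /\ forall k, partial k F u = alpha k u) ->
  smooth_on U F.
Proof.
move=> oU sa dF [|m] /=.
  by move=> u Uu; apply: differentiable_continuous; have [] := dF u Uu.
split=> [u Uu|k]; first by have [] := dF u Uu.
apply: eq_class_C oU _ (sa k m) => u; rewrite inE => Uu.
by have [_ ->] := dF u Uu.
Qed.

Lemma partial_coordinate k (s : 'I_n) u :
  partial k (fun w : 'rV[R]_n => w 0 s : R^o) u = (k == s)%:R.
Proof.
have dI : differentiable (@id 'rV[R]_n) u by [].
have := derive_mx (diff_derivable (v := delta_mx 0 k) dI).
rewrite derive_id => /matrixP /(_ 0 s); rewrite !mxE eqxx /= => E.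
by rewrite /partial -E eq_sym.
Qed.

Lemma smooth_coordinate U (s : 'I_n) : smooth_on U (fun w : 'rV[R]_n => w 0 s : R^o).
Proof.
have pE k : partial k (fun w : 'rV[R]_n => w 0 s : R^o) = fun=> (k == s)%:R.
  by apply/funext => u; exact: partial_coordinate.
case=> [|m] /=; first by move=> u _; exact: coord_continuous.
split=> [u _|k]; first exact: differentiable_coord.
by rewrite pE; exact: class_C_cst.
Qed.

Lemma partial_entry p q (M : 'rV[R]_n -> 'M[R]_(p, q)) i j k u :
  (forall i j, differentiable (fun w => M w i j : R^o) u) ->
  partial k M u i j = partial k (fun w => M w i j : R^o) u.
Proof.
move=> dM; rewrite /partial derive_mx ?mxE//.
by apply/derivable_mxP => i' j'; exact/diff_derivable/dM.
Qed.

End SmoothScalar.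

(** * The conormal of the hypersurface *)

Section Hypersurface.
Variables (R : realType) (n : nat) (U : set 'rV[R]_n).
Variables (f : 'rV[R]_n -> 'rV[R]_n) (phi : 'rV[R]_n -> R).
Hypothesis oU : open U.
Hypothesis sf : smooth_on U f.
Hypothesis sphi : smooth_on U (phi : _ -> R^o).
Notation r := (radius_vector f phi).

(** The differential of a scalar function, as a column. *)
Definition gradient (F : 'rV[R]_n -> R^o) (u : 'rV[R]_n) : 'cV[R]_n :=
  \col_k partial k F u.

(** The row of index k is the partial derivative d_k r of the radius-vector. *)
Definition jacobian_rows (u : 'rV[R]_n) : 'M[R]_(n, 1 + n) :=
  \matrix_k partial k r u.

(** The matrix phi - v; it is invertible where phi is not a characteristic
    velocity. *)
Definition resolvent (u : 'rV[R]_n) : 'M[R]_n := (phi u)%:M - velocity_mx f u.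

Lemma radius_vector_0 w : r w 0 (lshift n 0) = phi w.
Proof. by rewrite /radius_vector row_mxEl !mxE eqxx mulr1n. Qed.

Lemma radius_vector_S w s : r w 0 (rshift 1 s) = phi w * w 0 s - f w 0 s.
Proof. by rewrite /radius_vector row_mxEr !mxE. Qed.

Lemma smooth_f s : smooth_on U (fun w => f w 0 s : R^o).
Proof. by move=> m; apply: class_C_coord => //; exact: sf. Qed.

Lemma smooth_radius_vector i m : smooth_on U (fun w => r w i m : R^o).
Proof.
rewrite ord1 => p; case: (split_ordP m) => s ->.
  have -> : (fun w => r w 0 (lshift n s) : R^o) = (phi : _ -> R^o).
    by apply/funext => w; rewrite [s]ord1 radius_vector_0.
  exact: sphi.
have -> : (fun w => r w 0 (rshift 1 s) : R^o) =
    (fun w => phi w * w 0 s + (-1) * f w 0 s : R^o).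
  by apply/funext => w; rewrite radius_vector_S mulN1r.
apply: (class_CD oU).
  by apply: (class_CM oU); [exact: sphi|exact: smooth_coordinate].
by apply: (class_CM oU); [exact: class_C_cst|exact: smooth_f].
Qed.

Lemma jacobian_rowsE u : U u -> jacobian_rows u =
  row_mx (gradient phi u) (gradient phi u *m u + (resolvent u)^T).
Proof.
move=> Uu; have dr i m : differentiable (fun w => r w i m : R^o) u.
  exact: smooth_differentiable (smooth_radius_vector i m) Uu.
have dphi : differentiable (phi : _ -> R^o) u by exact: smooth_differentiable sphi Uu.
have df s : differentiable (fun w => f w 0 s : R^o) u.
  exact: smooth_differentiable (smooth_f s) Uu.
have dx s : differentiable (fun w : 'rV[R]_n => w 0 s : R^o) u.
  exact: differentiable_coord.
apply/matrixP => k m; rewrite mxE partial_entry//.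
case: (split_ordP m) => s ->.
  have -> : (fun w => r w 0 (lshift n s) : R^o) = (phi : _ -> R^o).
    by apply/funext => w; rewrite [s]ord1 radius_vector_0.
  by rewrite row_mxEl mxE.
rewrite row_mxEr !mxE big_ord1 !mxE.
have -> : (fun w => r w 0 (rshift 1 s) : R^o) =
    (fun w => (fun w => phi w * w 0 s : R^o) w + (fun w => - f w 0 s : R^o) w : R^o).
  by apply/funext => w; rewrite radius_vector_S.
rewrite partialD; [|exact: differentiableM|exact: differentiableN].
rewrite partialM// partialN// partial_coordinate.
rewrite [s == k]eq_sym -mulr_natr; ring.
Qed.

Variables (alpha : 'I_n -> 'rV[R]_n -> R^o).
Hypothesis dalpha : forall k u, U u -> differentiable (alpha k) u.

(** The coefficients of the 1-form alpha, as a column. *)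
Definition form_col (u : 'rV[R]_n) : 'cV[R]_n := \col_s alpha s u.

(** The matrix with entries d_l alpha_s, where s is the row index. *)
Definition form_jacobian (u : 'rV[R]_n) : 'M[R]_n :=
  \matrix_(s, l) partial l (alpha s) u.

(** The matrix Q_sl = d_l alpha_s + alpha_s alpha_l.  When alpha = d (ln h), it
    is the Hessian of h divided by h. *)
Definition log_hessian (u : 'rV[R]_n) : 'M[R]_n :=
  form_jacobian u + form_col u *m (form_col u)^T.

(** The equation alpha (phi - v) = - dphi, in transposed form. *)
Hypothesis alphaE : forall u, U u ->
  (resolvent u)^T *m form_col u = - gradient phi u.

(** The linear form (1 - alpha(u), alpha) on the ambient space, as a column; it
    annihilates the tangent space when alpha (phi - v) = - dphi. *)
Definition conormal (u : 'rV[R]_n) : 'cV[R]_(1 + n) :=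
  col_mx (1%:M - u *m form_col u) (form_col u).

(** The column of index l is the partial derivative d_l of the conormal. *)
Definition conormal_jacobian (u : 'rV[R]_n) : 'M[R]_(1 + n, n) :=
  \matrix_(m, l) partial l (fun w => conormal w m 0 : R^o) u.

Lemma conormal_neq0 u : conormal u != 0.
Proof.
apply/eqP => A0; have := A0; rewrite /conormal -[0 in RHS]vsubmxK.
move=> /eq_col_mx; rewrite !linear0 => -[E1 E2].
by move: E1; rewrite E2 mulmx0 subr0 => /matrixP /(_ 0 0) /eqP; rewrite !mxE oner_eq0.
Qed.

Lemma jacobian_conormal u : U u -> jacobian_rows u *m conormal u = 0.
Proof.
move=> Uu; rewrite jacobian_rowsE// mul_row_col mulmxBr mulmx1 mulmxDl.
by rewrite mulmxA alphaE// addrA subrK subrr.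
Qed.

Lemma conormal_0 w : conormal w (lshift n 0) 0 = 1 - \sum_s w 0 s * alpha s w.
Proof.
rewrite col_mxEu !mxE; congr (_ - _); apply: eq_bigr => s _.
by rewrite !mxE.
Qed.

Lemma conormal_S w s : conormal w (rshift 1 s) 0 = alpha s w.
Proof. by rewrite col_mxEd mxE. Qed.

Lemma differentiable_conormal u m : U u ->
  differentiable (fun w => conormal w m 0 : R^o) u.
Proof.
move=> Uu; case: (split_ordP m) => s ->; last first.
  have -> : (fun w => conormal w (rshift 1 s) 0 : R^o) = alpha s.
    by apply/funext => w; rewrite conormal_S.
  exact: dalpha.
have -> : (fun w => conormal w (lshift n s) 0 : R^o) =
    cst 1 - \sum_s (fun w : 'rV[R]_n => w 0 s * alpha s w : R^o).
  by apply/funext => w; rewrite [s]ord1 conormal_0 !fctE fct_sumE.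
apply: differentiableB => //; apply: differentiable_sum => j.
by apply: differentiableM; [exact: differentiable_coord|exact: dalpha].
Qed.

Lemma conormal_jacobianE u : U u -> conormal_jacobian u =
  col_mx (- (form_col u)^T - u *m form_jacobian u) (form_jacobian u).
Proof.
move=> Uu; apply/matrixP => m l; rewrite mxE; case: (split_ordP m) => s ->.
  rewrite col_mxEu [s]ord1 !mxE.
  have -> : (fun w => conormal w (lshift n 0) 0 : R^o) = (fun w =>
      (cst 1 : _ -> R^o) w +
      (fun w => - (fun w => \sum_s (w : 'rV[R]_n) 0 s * alpha s w : R^o) w : R^o) w : R^o).
    by apply/funext => w; rewrite conormal_0.
  have dp j : differentiable (fun w : 'rV[R]_n => w 0 j * alpha j w : R^o) u.
    by apply: differentiableM; [exact: differentiable_coord|exact: dalpha].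
  have ds : differentiable (fun w => \sum_s (w : 'rV[R]_n) 0 s * alpha s w : R^o) u.
    have -> : (fun w => \sum_s (w : 'rV[R]_n) 0 s * alpha s w : R^o) =
        \sum_s (fun w : 'rV[R]_n => w 0 s * alpha s w : R^o).
      by apply/funext => w; rewrite fct_sumE.
    exact: differentiable_sum.
  rewrite partialD//; last exact: differentiableN.
  rewrite partialN// {1}/partial derive_cst add0r -opprD; congr (- _).
  rewrite partial_sum//.
  transitivity (\sum_j ((l == j)%:R * alpha j u + u 0 j * partial l (alpha j) u)).
    apply: eq_bigr => j _; rewrite partialM ?partial_coordinate//.
    - by rewrite addrC mulrC.
    - exact: differentiable_coord.
    - exact: dalpha.
  rewrite big_split /=; congr (_ + _); last first.
    by apply: eq_bigr => j _; rewrite !mxE.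
  rewrite (bigD1 l)//= eqxx mul1r big1 ?addr0// => j.
  by rewrite eq_sym => /negbTE ->; rewrite mul0r.
have -> : (fun w => conormal w (rshift 1 s) 0 : R^o) = alpha s.
  by apply/funext => w; rewrite conormal_S.
by rewrite col_mxEd mxE.
Qed.

(** The pairing of d_k r with d_l of the conormal.  The derivatives of alpha
    times the point u cancel between the two blocks. *)
Lemma jacobian_conormal_jacobian u : U u ->
  jacobian_rows u *m conormal_jacobian u = (resolvent u)^T *m log_hessian u.
Proof.
move=> Uu; rewrite jacobian_rowsE// conormal_jacobianE// mul_row_col.
rewrite mulmxBr mulmxN mulmxDl !mulmxA addrA subrK /log_hessian mulmxDr.
by rewrite mulmxA alphaE// mulNmx addrC.
Qed.

End Hypersurface.

(** * Conjugacy in terms of the form alpha *)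

Section Conjugacy.
Variables (R : realType) (n : nat) (U : set 'rV[R]_n).
Variables (f : 'rV[R]_n -> 'rV[R]_n) (lambda : 'I_n -> 'rV[R]_n -> R).
Variables (xi : 'I_n -> 'rV[R]_n -> 'cV[R]_n) (phi : 'rV[R]_n -> R).
Hypothesis oU : open U.
Hypothesis sf : smooth_on U f.
Hypothesis sxi : forall i, smooth_on U (xi i).
Hypothesis sphi : smooth_on U (phi : _ -> R^o).
Hypothesis hyp : strictly_hyperbolic U f lambda.
Hypothesis eig : right_eigenvectors U f lambda xi.
Hypothesis phi_neq : forall u, U u -> forall i, phi u != lambda i u.
Notation r := (radius_vector f phi).

(** The matrix whose rows are the transposed right eigenvectors. *)
Definition eigenrows (u : 'rV[R]_n) : 'M[R]_n := \matrix_i (xi i u)^T.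

Lemma eigenrows_eigen u i : U u ->
  row i (eigenrows u) *m (velocity_mx f u)^T = lambda i u *: row i (eigenrows u).
Proof.
by move=> Uu; rewrite rowK -trmx_mul; have [_ ->] := eig Uu i; rewrite linearZ.
Qed.

Lemma eigenrows_unit u : U u -> eigenrows u \in unitmx.
Proof.
move=> Uu; apply: (row_free_eigenvectors (g := (velocity_mx f u)^T) (a := lambda^~ u)).
- by have [_] := hyp Uu.
- move=> i; rewrite rowK; apply/eqP => /(congr1 trmx); rewrite trmxK trmx0.
  by apply/eqP; have [] := eig Uu i.
- by move=> i; exact: eigenrows_eigen.
Qed.

Lemma resolvent_unit u : U u -> resolvent f phi u \in unitmx.
Proof.
move=> Uu; apply: (unitmx_shift (eigenrows_unit Uu)) => i.
  exact: eigenrows_eigen.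
exact: phi_neq.
Qed.

Lemma resolvent_eigenvector u i : U u ->
  resolvent f phi u *m xi i u = (phi u - lambda i u) *: xi i u.
Proof.
move=> Uu; rewrite mulmxBl mul_scalar_mx scalerBl.
by have [_ ->] := eig Uu i.
Qed.

Lemma lie_radius_vector u k :
  lie (xi k) r u = (xi k u)^T *m jacobian_rows f phi u.
Proof.
rewrite /lie mulmx_sum_row; apply: eq_bigr => j _.
by rewrite mxE rowK.
Qed.

Lemma tangent_spaceE u :
  tangent_space xi r u = eigenrows u *m jacobian_rows f phi u.
Proof.
by apply/row_matrixP => k; rewrite row_mul !rowK lie_radius_vector.
Qed.

(** The tangent space projects onto R^n along the line through u of the
    congruence, whose direction is (1, u); since phi is not a characteristic
    velocity, this projection of the tangent space is onto. *)
Lemma rank_tangent_space u : U u -> \rank (tangent_space xi r u) = n.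
Proof.
move=> Uu; apply/eqP; rewrite eqn_leq rank_leq_row /=.
(* The matrix col_mx (- u) 1 is the projection onto R^n along (1, u). *)
have E : tangent_space xi r u *m col_mx (- u) 1%:M =
    eigenrows u *m (resolvent f phi u)^T.
  rewrite tangent_spaceE -mulmxA (jacobian_rowsE oU sf sphi Uu) mul_row_col.
  by rewrite mulmxN mulmx1 addrA addNr add0r.
apply: leq_trans (mxrankM_maxl _ (col_mx (- u) 1%:M)).
rewrite E mxrank_unit// unitmx_mul eigenrows_unit// unitmx_tr.
exact: resolvent_unit.
Qed.

Lemma lie_entry u j m : U u -> lie (xi j) r u 0 m =
  \sum_k xi j u k 0 * partial k (fun w => r w 0 m : R^o) u.
Proof.
move=> Uu; rewrite /lie summxE; apply: eq_bigr => k _.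
rewrite mxE partial_entry// => i' m'.
exact: smooth_differentiable (smooth_radius_vector oU sf sphi i' m') Uu.
Qed.

Lemma differentiable_lie_entry u j i m : U u ->
  differentiable (fun w => lie (xi j) r w i m : R^o) u.
Proof.
rewrite [i]ord1 => Uu.
pose F w : R^o := \sum_k xi j w k 0 * partial k (fun w => r w 0 m : R^o) w.
have sF : smooth_on U F.
  move=> p; apply: class_C_sum => // k; apply: (class_CM oU).
    by apply: class_C_coord => //; exact: sxi.
  exact: smooth_partial (smooth_radius_vector oU sf sphi 0 m) p.
apply: (eq_differentiable oU Uu _ (smooth_differentiable sF Uu)) => w.
by rewrite inE => Uw; rewrite lie_entry.
Qed.

Variable alpha : 'I_n -> 'rV[R]_n -> R^o.
Hypothesis dalpha : forall k u, U u -> differentiable (alpha k) u.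
Hypothesis alphaE : forall u, U u ->
  (resolvent f phi u)^T *m form_col alpha u = - gradient phi u.

Lemma lie_conormal u j : U u -> lie (xi j) r u *m conormal alpha u = 0.
Proof.
move=> Uu; rewrite lie_radius_vector -mulmxA.
by rewrite (jacobian_conormal oU sf sphi alphaE Uu) mulmx0.
Qed.

(** Obtained by differentiating the identity of [lie_conormal] along L_i. *)
Lemma lie_lie_conormal u i j : U u ->
  lie (xi i) (lie (xi j) r) u *m conormal alpha u =
  - (lie (xi j) r u *m conormal_jacobian alpha u *m xi i u).
Proof.
move=> Uu; apply/eqP; rewrite -addr_eq0; apply/eqP/matrixP => a b.
rewrite [a]ord1 [b]ord1 [RHS]mxE -mulmxA.
have dL m : differentiable (fun w => lie (xi j) r w 0 m : R^o) u.
  exact: differentiable_lie_entry.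
have dA m : differentiable (fun w => conormal alpha w m 0 : R^o) u.
  exact: (differentiable_conormal dalpha).
(* The derivative d_l of the identity of lie_conormal, entry by entry. *)
have key l : \sum_m
    (partial l (fun w => lie (xi j) r w 0 m : R^o) u * conormal alpha u m 0
    + lie (xi j) r u 0 m * partial l (fun w => conormal alpha w m 0 : R^o) u) = 0.
  transitivity (partial l
      (fun w => \sum_m lie (xi j) r w 0 m * conormal alpha w m 0 : R^o) u).
    rewrite partial_sum => [|m]; last exact: differentiableM.
    by apply: eq_bigr => m _; rewrite partialM// addrC; congr (_ + _); rewrite mulrC.
  transitivity (partial l (fun=> 0 : R^o) u); last exact: derive_cst.
  apply: eq_partial oU Uu _ => w; rewrite inE => Uw.
  by have /matrixP/(_ 0 0) := lie_conormal j Uw; rewrite !mxE.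
have E m : lie (xi i) (lie (xi j) r) u 0 m =
    \sum_l xi i u l 0 * partial l (fun w => lie (xi j) r w 0 m : R^o) u.
  rewrite {1}/lie summxE; apply: eq_bigr => l _; rewrite mxE partial_entry//.
  by move=> i' m'; exact: differentiable_lie_entry.
transitivity (\sum_l xi i u l 0 *
    \sum_m
    (partial l (fun w => lie (xi j) r w 0 m : R^o) u * conormal alpha u m 0
    + lie (xi j) r u 0 m * partial l (fun w => conormal alpha w m 0 : R^o) u)); last first.
  by rewrite big1// => l _; rewrite key mulr0.
under [RHS]eq_bigr do rewrite mulr_sumr.
rewrite exchange_big mxE [X in X + _]mxE [X in _ + X]mxE -big_split /=.
apply: eq_bigr => m _; rewrite E mulr_suml [X in _ + _ * X]mxE mulr_sumr -big_split.
apply: eq_bigr => l _; rewrite [conormal_jacobian _ _ _ _]mxE mulrDr.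
by congr (_ + _); rewrite mulrA// mulrC.
Qed.

(** Conjugacy at a point.  The form alpha may be any solution of
    alpha (phi - v) = - dphi, which allows the use of dh / h below. *)
Lemma conjugate_at u i j : U u ->
  (lie (xi i) (lie (xi j) r) u <= tangent_space xi r u)%MS <->
  (xi j u)^T *m log_hessian alpha u *m xi i u = 0.
Proof.
move=> Uu; have TA : tangent_space xi r u *m conormal alpha u = 0.
  by rewrite tangent_spaceE -mulmxA (jacobian_conormal oU sf sphi alphaE Uu) mulmx0.
have S := submx_annihilator _ (rank_tangent_space Uu) (conormal_neq0 alpha u) TA.
have E : lie (xi i) (lie (xi j) r) u *m conormal alpha u =
    - ((phi u - lambda j u) *: ((xi j u)^T *m log_hessian alpha u *m xi i u)).
  rewrite lie_lie_conormal// lie_radius_vector.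
  rewrite -(mulmxA _ (jacobian_rows f phi u) (conormal_jacobian alpha u)).
  rewrite (jacobian_conormal_jacobian oU sf sphi dalpha alphaE Uu) mulmxA -trmx_mul.
  by rewrite resolvent_eigenvector// linearZ /= -!scalemxAl.
split=> [/S|Q0].
  rewrite E => /eqP; rewrite oppr_eq0 scaler_eq0 subr_eq0 (negbTE (phi_neq Uu j)).
  by move=> /eqP.
by apply/S; rewrite E Q0 scaler0 oppr0.
Qed.

End Conjugacy.

(** * Conservation laws *)

Section Representation.
Variables (R : realType) (n : nat) (U : set 'rV[R]_n).
Variables (f : 'rV[R]_n -> 'rV[R]_n) (lambda : 'I_n -> 'rV[R]_n -> R).
Variables (xi : 'I_n -> 'rV[R]_n -> 'cV[R]_n) (phi : 'rV[R]_n -> R).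
Hypothesis oU : open U.
Hypothesis sf : smooth_on U f.
Hypothesis sxi : forall i, smooth_on U (xi i).
Hypothesis sphi : smooth_on U (phi : _ -> R^o).
Hypothesis hyp : strictly_hyperbolic U f lambda.
Hypothesis eig : right_eigenvectors U f lambda xi.
Hypothesis phi_neq : forall u, U u -> forall i, phi u != lambda i u.
Notation r := (radius_vector f phi).

(** The solution - dphi (phi - v)^-1 of alpha (phi - v) = - dphi, with the
    inverse written by cofactors so that its smoothness is visible. *)
Definition canonical_form (k : 'I_n) (u : 'rV[R]_n) : R^o :=
  (-1) * ((\det (resolvent f phi u))^-1 *
    \sum_j \adj (resolvent f phi u) j k * partial j (phi : _ -> R^o) u).

Lemma canonical_formE u : U u ->
  (resolvent f phi u)^T *m form_col canonical_form u = - gradient phi u.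
Proof.
move=> Uu; have := resolvent_unit hyp eig phi_neq Uu.
set N := resolvent f phi u => uN.
have -> : form_col canonical_form u = - ((\det N)^-1 *: ((\adj N)^T *m gradient phi u)).
  apply/colP => k; rewrite !mxE /canonical_form mulN1r; congr (- (_ * _)).
  by apply: eq_bigr => j _; rewrite !mxE.
rewrite mulmxN -scalemxAr mulmxA -trmx_mul mul_adj_mx tr_scalar_mx mul_scalar_mx.
by rewrite scalerA mulVf ?scale1r// -unitfE -unitmxE.
Qed.

Lemma smooth_resolvent i j : smooth_on U (fun w => resolvent f phi w i j : R^o).
Proof.
move=> m; have -> : (fun w => resolvent f phi w i j : R^o) = (fun w =>
    phi w * (i == j)%:R + (-1) * partial j (fun w => f w 0 i : R^o) w : R^o).
  by apply/funext => w; rewrite !mxE mulN1r mulr_natr.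
apply: (class_CD oU); apply: (class_CM oU).
- exact: sphi.
- exact: class_C_cst.
- exact: class_C_cst.
- exact: smooth_partial (smooth_f oU sf i) m.
Qed.

Lemma smooth_canonical_form k : smooth_on U (canonical_form k).
Proof.
move=> m; apply: (class_CM oU); first exact: class_C_cst.
apply: (class_CM oU).
  apply: (class_CV oU).
    move=> u Uu; rewrite -unitfE -unitmxE.
    exact: (resolvent_unit hyp eig phi_neq Uu).
  by apply: (class_C_det oU) => i j; exact: smooth_resolvent.
apply: (class_C_sum _ _ oU) => j; apply: (class_CM oU); last first.
  exact: smooth_partial sphi m.
have -> : (fun w => \adj (resolvent f phi w) j k : R^o) = (fun w =>
    (-1) ^+ (k + j) * \det (row' k (col' j (resolvent f phi w))) : R^o).
  by apply/funext => w; rewrite mxE.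
apply: (class_CM oU); first exact: class_C_cst.
apply: (class_C_det oU) => i i'.
have -> : (fun w => row' k (col' j (resolvent f phi w)) i i' : R^o) =
    (fun w => resolvent f phi w (lift k i) (lift j i') : R^o).
  by apply/funext => w; rewrite !mxE.
exact: smooth_resolvent.
Qed.

Lemma resolvent_sum (alpha : 'I_n -> 'rV[R]_n -> R^o) u l :
  ((resolvent f phi u)^T *m form_col alpha u) l 0 =
  phi u * alpha l u - \sum_s alpha s u * velocity_mx f u s l.
Proof.
rewrite linearB /= tr_scalar_mx mulmxBl mul_scalar_mx !mxE; congr (_ - _).
by apply: eq_bigr => s _; rewrite !mxE mulrC.
Qed.

Lemma conjugate_symmetric (alpha : 'I_n -> 'rV[R]_n -> R^o) u : U u ->
  (forall i j, i != j -> (xi j u)^T *m log_hessian alpha u *m xi i u = 0) ->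
  forall k l, partial l (alpha k) u = partial k (alpha l) u.
Proof.
move=> Uu Q0; have uX := eigenrows_unit hyp eig Uu.
have : (log_hessian alpha u)^T = log_hessian alpha u.
  apply: (congr_sym uX) => i j ij.
  have -> : (eigenrows xi u *m log_hessian alpha u *m (eigenrows xi u)^T) i j =
     ((xi i u)^T *m log_hessian alpha u *m xi j u) 0 0.
    have -> : (xi i u)^T = row i (eigenrows xi u) by rewrite rowK.
    have -> : xi j u = col j (eigenrows xi u)^T by rewrite -tr_row rowK trmxK.
    by rewrite -!row_mul !mxE; apply: eq_bigr => k _; rewrite !mxE.
  by rewrite Q0 ?mxE// eq_sym.
move=> /matrixP E k l; have := E l k; rewrite !mxE !big_ord1 !mxE.
by rewrite [alpha l u * _]mulrC => /addIr.
Qed.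

Lemma conjugate_representable u0 e : ball u0 e `<=` U ->
  conjugate_to_congruence U xi r -> representable (ball u0 e) f phi.
Proof.
move=> BU cg; have oB := ball_open u0 e.
have sa k : smooth_on (ball u0 e) (canonical_form k).
  exact: smooth_subset BU (smooth_canonical_form k).
have da k u : U u -> differentiable (canonical_form k) u.
  by move=> Uu; exact: smooth_differentiable (smooth_canonical_form k) Uu.
have acl u : ball u0 e u -> forall k l,
    partial l (canonical_form k) u = partial k (canonical_form l) u.
  move=> /BU Uu; apply: conjugate_symmetric => // i j ij.
  apply/(conjugate_at oU sf sxi sphi hyp eig phi_neq da canonical_formE _ _ Uu).
  exact: cg.
have [psi dpsi] := poincare (fun k => sa k 1%N) acl.
have spsi : smooth_on (ball u0 e) psi by exact: smooth_primitive oB sa dpsi.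
(* ln h must be a primitive of alpha, as dh = h alpha. *)
pose h u : R^o := expR (psi u); pose g u : R^o := phi u * h u.
have sh : smooth_on (ball u0 e) h by move=> m; apply: class_C_exp => //; exact: spsi.
have sphiB := smooth_subset BU sphi.
have dh u k : ball u0 e u -> partial k h u = h u * canonical_form k u.
  by move=> Bu; have [dp pE] := dpsi u Bu; rewrite partial_exp// pE.
exists h, g; split; last 2 first.
- by move=> u _; rewrite gt_eqF// expR_gt0.
- by move=> u _; rewrite /g mulfK// gt_eqF// expR_gt0.
split => //; first by move=> m; apply: (class_CM oB); [exact: sphiB|exact: sh].
move=> u Bu k; rewrite /g partialM; last 2 first.
- exact: smooth_differentiable sphiB Bu.
- exact: smooth_differentiable sh Bu.
rewrite dh//; have /matrixP/(_ k 0) := canonical_formE (BU _ Bu).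
rewrite resolvent_sum 2!mxE => E.
under [in RHS]eq_bigr do rewrite dh// -mulrA.
rewrite -mulr_sumr mulrCA -mulrDr; congr (_ * _).
by rewrite -[X in _ + X]opprK -E; ring.
Qed.

(** The representation on the whole of U is assumed here; as conjugacy is a
    pointwise condition, a local representation is enough in the theorem. *)
Lemma representable_conjugate : (exists h g : 'rV[R]_n -> R,
   [/\ conservation_law U f h g, forall u, U u -> h u != 0 &
       forall u, U u -> phi u = g u / h u]) ->
  conjugate_to_congruence U xi r.
Proof.
move=> [h [g [[sh sg gE] h0 phiE]]].
have dh u : U u -> differentiable (h : _ -> R^o) u := smooth_differentiable sh.
have dph k u : U u -> differentiable (partial k (h : _ -> R^o)) u.
  by move=> Uu; exact: smooth_differentiable (smooth_partial k sh) Uu.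
have dphi u : U u -> differentiable (phi : _ -> R^o) u := smooth_differentiable sphi.
pose alpha k u : R^o := partial k (h : _ -> R^o) u * (h u)^-1.
have da k u : U u -> differentiable (alpha k) u.
  move=> Uu; apply: differentiableM; first exact: dph.
  by apply: differentiableV; [exact: dh|exact: h0].
have ah k u : U u -> partial k (h : _ -> R^o) u = alpha k u * h u.
  by move=> Uu; rewrite /alpha divfK// h0.
have pg u k : U u -> partial k (g : _ -> R^o) u =
    phi u * partial k (h : _ -> R^o) u + h u * partial k (phi : _ -> R^o) u.
  move=> Uu; rewrite -partialM; [|exact: dphi|exact: dh].
  apply: eq_partial oU Uu _ => w; rewrite inE => Uw.
  by rewrite phiE// divfK// h0.
have aE u : U u -> (resolvent f phi u)^T *m form_col alpha u = - gradient phi u.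
  move=> Uu; apply/colP => l; rewrite resolvent_sum [RHS]mxE mxE.
  apply: (mulIf (h0 u Uu)); rewrite mulrBl -mulrA -ah// mulr_suml.
  under eq_bigr do rewrite mulrAC -ah//.
  by rewrite -gE// pg//; ring.
have young2 (F : 'rV[R]_n -> R^o) u k l : U u -> smooth_on U F ->
    partial l (partial k F) u = partial k (partial l F) u.
  move=> Uu sF; rewrite /partial; apply: (young oU Uu).
  - by move=> w Uw; exact: smooth_differentiable sF Uw.
  - exact: smooth_differentiable (smooth_partial k sF) Uu.
  - exact: smooth_differentiable (smooth_partial l sF) Uu.
move=> u Uu i j ij.
apply/(conjugate_at oU sf sxi sphi hyp eig phi_neq da aE _ _ Uu).
pose H : 'M[R]_n := \matrix_(s, l) partial l (partial s (h : _ -> R^o)) u.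
have HQ : H = h u *: log_hessian alpha u.
  apply/matrixP => s l; rewrite !mxE big_ord1 !mxE.
  rewrite (eq_partial (G := fun w => alpha s w * h w) _ oU Uu); last first.
    by move=> w; rewrite inE => Uw; exact: ah.
  by rewrite partialM; [|exact: da|exact: dh]; rewrite ah//; ring.
have HT : H^T = H by apply/matrixP => s l; rewrite !mxE; exact: young2.
(* The entry (l, k) of H v is d_l d_k g minus d_s h d_l d_k f^s, which is
   symmetric in k and l. *)
have HvT : (H *m velocity_mx f u)^T = H *m velocity_mx f u.
  have E k l : (H *m velocity_mx f u) l k = partial l (partial k (g : _ -> R^o)) u -
      \sum_s partial s (h : _ -> R^o) u *
        partial l (partial k (fun w => f w 0 s : R^o)) u.
    have dv s : differentiable (partial k (fun w => f w 0 s : R^o)) u.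
      exact: smooth_differentiable (smooth_partial k (smooth_f oU sf s)) Uu.
    rewrite (eq_partial (G := fun w => \sum_s partial s (h : _ -> R^o) w *
      partial k (fun w => f w 0 s : R^o) w) _ oU Uu); last first.
      move=> w; rewrite inE => Uw; rewrite gE//.
      by apply: eq_bigr => s _; rewrite mxE.
    rewrite partial_sum => [|s]; last by apply: differentiableM; [exact: dph|exact: dv].
    rewrite -sumrB mxE; apply: eq_bigr => s _.
    rewrite partialM; [|exact: dph|exact: dv].
    by rewrite addrC addKr mulrC -HT !mxE.
  have S k l :
      \sum_s partial s (h : _ -> R^o) u *
        partial l (partial k (fun w => f w 0 s : R^o)) u =
      \sum_s partial s (h : _ -> R^o) u *
        partial k (partial l (fun w => f w 0 s : R^o)) u.
    by apply: eq_bigr => s _; rewrite (young2 _ _ k l Uu (smooth_f oU sf s)).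
  apply/matrixP => l k; rewrite mxE (E l k) (E k l) (young2 _ _ k l Uu sg).
  exact: (congr1 (fun z => partial k (partial l (g : _ -> R^o)) u - z) (esym (S k l))).
have [_ inj] := hyp Uu.
have xj := (eig Uu j).2; have xi' := (eig Uu i).2.
have := orth_eigen HT HvT xj xi'; rewrite HQ -scalemxAr -scalemxAl.
have jie : lambda j u != lambda i u.
  by apply: contra ij => /eqP/inj ->.
move=> /(_ jie)/eqP; rewrite scaler_eq0 (negbTE (h0 u Uu)) => /eqP //.
Qed.

End Representation.

Theorem theorem1 (R : realType) (n : nat) (U : set 'rV[R]_n)
    (f : 'rV[R]_n -> 'rV[R]_n)
    (lambda : 'I_n -> 'rV[R]_n -> R)
    (xi : 'I_n -> 'rV[R]_n -> 'cV[R]_n)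
    (phi : 'rV[R]_n -> R)
    (openU : open U)
    (f_smooth : smooth_on U f)
    (lambda_smooth : forall i, smooth_on U (lambda i : _ -> R^o))
    (xi_smooth : forall i, smooth_on U (xi i))
    (phi_smooth : smooth_on U (phi : _ -> R^o))
    (hyp : strictly_hyperbolic U f lambda)
    (eigenvec : right_eigenvectors U f lambda xi)
    (phi_neq : forall u, U u -> forall i, phi u != lambda i u) :
  conjugate_to_congruence U xi (radius_vector f phi) <->
  locally_representable U f phi.
Proof.
split=> [cg u0 Uu0|rep].
  have /nbhs_ballP[e /= e0 BU] := open_nbhs_nbhs (conj openU Uu0).
  exists e; split => //.
  exact: (conjugate_representable openU f_smooth xi_smooth phi_smooth hyp
    eigenvec phi_neq BU cg).
move=> u Uu; have [e [e0 BU rB]] := rep u Uu.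
have := representable_conjugate (ball_open u e) (smooth_subset BU f_smooth)
  (fun i => smooth_subset BU (xi_smooth i)) (smooth_subset BU phi_smooth)
  (fun w Bw => hyp w (BU w Bw)) (fun w Bw => eigenvec w (BU w Bw))
  (fun w Bw => phi_neq w (BU w Bw)) rB.
by apply; exact: ballxx.
Qed.
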